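(* Let $U\in C^{2}([y_{1},y_{2}])$ and assume that for every $c\in(U_{\min},U_{\max})$ the set $\{y\in[y_1,y_2]: U(y)=c\}$ is finite, where $U_{\min}=\min U$, $U_{\max}=\max U$. Let $(c_s,\alpha_s,\beta,\phi_s)$ be a neutral mode with $\phi_s\in H^{2}(y_1,y_2)$, i.e. $c_s\in\mathbb{R}$, $\alpha_s>0$, $\beta\in\mathbb{R}$, and $\phi_s\in H^2(y_1,y_2)$ is a nontrivial function solving $$-\phi_s''+\alpha_s^{2}\phi_s-\frac{\beta-U''}{U-c_s}\phi_s=0\quad\text{on }(y_1,y_2)\setminus\{U=c_s\},\qquad \phi_s(y_1)=\phi_s(y_2)=0.$$ Then $c_s$ satisfies one of the following: (i) $c_s=U(z)$ for some $z\in[y_1,y_2]$ with $\beta=U''(z)$; (ii) $c_s=U(y_1)$ or $c_s=U(y_2)$; (iii) $c_s$ is a critical value of $U$; (iv) $c_s\notin \mathrm{Ran}(U)$.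
   Context: This concerns the Rayleigh–Kuo equation arising from linearizing the 2D incompressible Euler equation with Coriolis force (beta-plane, parameter $\beta$) around a shear flow $(U(y),0)$ in the channel $y\in[y_1,y_2]$. *)

(* Defs.v *)
From HB Require Import structures.
From mathcomp Require Import all_boot all_order all_algebra.
From mathcomp Require Import all_classical all_reals all_analysis.
Set Implicit Arguments. Unset Strict Implicit. Unset Printing Implicit Defensive.
Import Order.TTheory GRing.Theory Num.Theory.
Import numFieldNormedType.Exports.
Local Open Scope classical_set_scope.
Local Open Scope ring_scope.

Definition deriv_within {R : realType} (a b : R) (f : R -> R) (x l : R) : Prop :=
  (fun y => (f y - f x) / (y - x)) @ within [set y | y \in `[a, b] /\ y != x] (nbhs x)
    --> l.

Definition C2_on {R : realType} (a b : R) (U U1 U2 : R -> R) : Prop :=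
  (forall x, x \in `[a, b] -> deriv_within a b U x (U1 x)) /\
  (forall x, x \in `[a, b] -> deriv_within a b U1 x (U2 x)) /\
  {within `[a, b], continuous U2}.

(* phi belongs to H^2(a,b) with weak second derivative g:
   phi and phi' are absolutely continuous, phi'' = g in L^2(a,b). *)
Definition H2_with_second_deriv {R : realType} (a b : R) (phi g : R -> R) : Prop :=
  measurable_fun `[a, b] g /\
  (lebesgue_measure : measure _ R).-integrable `[a, b] (fun t => ((g t) ^+ 2)%:E) /\
  exists phi1 : R -> R,
    (forall x, x \in `[a, b] ->
       phi1 x = phi1 a + Rintegral lebesgue_measure `[a, x] g) /\
    (forall x, x \in `[a, b] ->
       phi x = phi a + Rintegral lebesgue_measure `[a, x] phi1).

(* Main.v *)
(* Suppose that c_s is in the range of U but none of (i)-(iii) holds, and put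
   V = U - c_s; all zeros of V are then simple and interior. Where V vanishes,
   beta <> U'' and the continuity of phi' force phi to vanish. The sign of V
   changes at such a zero, so next to it there is a maximal interval without
   zeros of V on which beta V <= 0; phi vanishes at both its ends. There
   phi' phi - U' phi^2 / V has a nonnegative derivative and limit 0 at the ends,
   so Rolle's theorem gives a point with phi = phi' = 0. The coefficient of the
   equation is at worst of size 1 / |y - w| near any point w, hence uniqueness
   for the initial value problem holds even at zeros of V, and phi = 0. *)
Require Import Defs.
From HB Require Import structures.
From mathcomp Require Import all_boot all_order all_algebra.
From mathcomp Require Import all_classical all_reals all_analysis.
From mathcomp Require Import measurable_realfun.
From mathcomp Require Import ring lra.
Import Order.TTheory GRing.Theory Num.Theory.
Import numFieldNormedType.Exports.
Local Open Scope classical_set_scope.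
Local Open Scope ring_scope.
Set Implicit Arguments.
Unset Strict Implicit.
Unset Printing Implicit Defensive.

(** * Derivatives, primitives and the mean value theorem on a closed interval *)

Lemma within_continuous_ball (R : realType) (a b : R) (f : R -> R) :
  {within `[a, b], continuous f} <->
  forall x, x \in `[a, b] -> forall e, 0 < e ->
    exists2 d : R, 0 < d &
      forall y, y \in `[a, b] -> `|y - x| < d -> `|f y - f x| < e.
Proof.
split.
  move=> /subspace_continuousP cf x xab e e0.
  have /cvgrPdist_lt /(_ e e0) := cf x xab.
  rewrite near_withinE => /nbhs_ballP[d /= d0 H]; exists d => // y yab yx.
  by rewrite distrC; apply: (H y) => //; rewrite /ball /= distrC.
move=> cf; apply/subspace_continuousP => x xab; apply/cvgrPdist_lt => e e0.
have [d d0 H] := cf x xab e e0.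
rewrite near_withinE; apply/nbhs_ballP; exists d => // y /= yx yab.
by rewrite distrC; apply: H => //; rewrite distrC.
Qed.

(** Multiplying the difference quotient by [y - x] gives an estimate that also covers [y = x], where
    the quotient itself is excluded. *)
Lemma deriv_within_ball (R : realType) (a b : R) (f : R -> R) (x l : R) :
  deriv_within a b f x l -> forall e, 0 < e ->
    exists2 d : R, 0 < d &
      forall y, y \in `[a, b] -> `|y - x| < d ->
        `|f y - f x - l * (y - x)| <= e * `|y - x|.
Proof.
move=> /cvgrPdist_lt + e e0 => /(_ e e0).
rewrite near_withinE => /nbhs_ballP[d /= d0 H]; exists d => // y yab yxd.
have [->|yx] := eqVneq y x; first by rewrite !subrr mulr0 subr0 normr0 mulr0.
have yx0 : y - x != 0 by rewrite subr_eq0.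
have {}H : `|l - (f y - f x) / (y - x)| < e.
  by apply: (H y) => //; rewrite /ball /= distrC.
rewrite (_ : f y - f x - l * (y - x) = - (l - (f y - f x) / (y - x)) * (y - x)).
  by rewrite normrM normrN ler_wpM2r// ltW.
by field.
Qed.

Lemma deriv_within_continuous (R : realType) (a b : R) (f f1 : R -> R) :
  (forall x, x \in `[a, b] -> deriv_within a b f x (f1 x)) ->
  {within `[a, b], continuous f}.
Proof.
move=> df; apply/within_continuous_ball => x xab e e0.
have [d d0 H] := deriv_within_ball (df x xab) ltr01.
pose k := `|f1 x| + 1; have k0 : 0 < k by rewrite ltr_wpDl.
exists (Num.min d (e / k)); first by rewrite lt_min d0 divr_gt0.
move=> y yab; rewrite lt_min => /andP[yd ye].
have := H y yab yd; rewrite mul1r => H1.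
rewrite (_ : f y - f x = (f y - f x - f1 x * (y - x)) + f1 x * (y - x)); last by ring.
apply: (le_lt_trans (ler_normD _ _)); rewrite normrM.
move: ye; rewrite ltr_pdivlMr// /k => ye.
lra.
Qed.

Lemma deriv_within_is_derive (R : realType) (a b : R) (f : R -> R) (x l : R) :
  x \in `]a, b[ -> deriv_within a b f x l -> is_derive x 1 f l.
Proof.
rewrite in_itv/= => /andP[ax xb] df.
suff H : h^-1 *: (f (h *: 1 + x) - f x) @[h --> 0^'] --> l.
  by split; [apply/cvg_ex; exists l | apply/cvg_lim].
apply/cvgrPdist_le => e e0.
have [d d0 H] := deriv_within_ball df e0.
apply/nbhs_ballP; exists (Num.min d (Num.min (x - a) (b - x))) => /=.
  by rewrite !lt_min d0 !subr_gt0 ax.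
move=> h; rewrite /ball/= sub0r normrN !lt_min => /andP[hd /andP[hxa hbx]] h0.
have := H (h + x); rewrite in_itv/= addrK => /(_ _ hd).
have -> : a <= h + x <= b by move: hxa hbx; rewrite !ltr_norml; lra.
move=> /(_ isT).
rewrite /GRing.scale/= mulr1 => H1.
rewrite distrC -(ler_pM2r (x := `|h|)) ?normr_gt0// -normrM.
by rewrite (_ : (_ - _) * h = f (h + x) - f x - l * h) //; field.
Qed.

(** [F] is a primitive of [f] only in the integral sense. Integrals ignore null sets, so inside []p,
    q[] the integrand may be replaced by the continuous [h], and the fundamental theorem of calculus
    gives a classical derivative. This is how an equation valid almost everywhere becomes a
    pointwise one. *)
Lemma is_derive_Rintegral (R : realType) (a b p q x : R) (F f h : R -> R) :
  a < p -> p < x -> x < q -> q < b ->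
  lebesgue_measure.-integrable `[a, b] (EFin \o f) ->
  {within `[p, q], continuous h} ->
  {ae (lebesgue_measure : measure _ R), forall y, y \in `]p, q[ -> f y = h y} ->
  (forall y, y \in `[a, b] ->
     F y = F a + Rintegral lebesgue_measure `[a, y] f) ->
  is_derive x 1 F (h x).
Proof.
move=> ap px xq qb intf ch fh FE.
have pq : p < q by apply: lt_trans px xq.
have ih : lebesgue_measure.-integrable `]p, q] (EFin \o h).
  have := continuous_compact_integrable (@segment_compact _ p q) ch.
  by apply: integrableS => //; apply: subset_itv; rewrite bnd_simp.
have iS c d : a <= c -> d <= b ->
    lebesgue_measure.-integrable [set` Interval (BLeft c) (BRight d)] (EFin \o f).
  move=> ac db; apply: (integrableS _ _ _ intf) => //.
  by apply: subset_itv; rewrite bnd_simp.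
have FEh y : y \in `]p, q[ ->
    F y = F p + Rintegral lebesgue_measure `]p, y] h.
  rewrite in_itv/= => /andP[py yq].
  have ay : a <= y by lra.
  have yb : y <= b by lra.
  rewrite (FE y); last by rewrite in_itv/= ay.
  rewrite (FE p); last by rewrite in_itv/=; lra.
  rewrite -addrA; congr (_ + _).
  rewrite -[LHS](subrK (Rintegral lebesgue_measure `[a, p] f)) addrC.
  congr (_ + _); rewrite Rintegral_itvB ?bnd_simp; [|exact: iS|lra|lra].
  rewrite /Rintegral; congr fine; apply: ae_eq_integral => //.
  - move/integrableP : intf => [+ _]; apply: measurable_funS => //.
    by apply: subset_itv; rewrite bnd_simp//; lra.
  - move/integrableP : ih => [+ _]; apply: measurable_funS => //.
    by apply: subset_itv; rewrite bnd_simp//; lra.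
  - apply: filterS fh; first exact: (ae_filter_ringOfSetsType lebesgue_measure).
    move=> t H /=; rewrite in_itv/= => /andP[pt ty].
    by rewrite H// in_itv/= pt (le_lt_trans ty).
have hx : {for x, continuous h}.
  move/continuous_within_itvP : ch => /(_ pq)[+ _ _]; apply.
  by rewrite in_itv/= px.
have [dh eh] := continuous_FTC1 xq ih (px : (BRight p < BRight x)%O) hx.
have Fx : {near x, F =1 (fun y => F p + Rintegral lebesgue_measure `]p, y] h)}.
  have pxq : x \in `]p, q[ by rewrite in_itv/= px.
  by apply: filterS (near_in_itvoo pxq) => y /FEh.
apply: (near_eq_is_derive (f := fun y => F p + Rintegral lebesgue_measure `]p, y] h)).
  by apply: filterS Fx.
rewrite -[h x]add0r; apply: is_deriveD.
by split; [exact: dh | rewrite -derive1E; exact: eh].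
Qed.

(** The two distance bounds say that [c] lies strictly between [x] and [y] without fixing their
    order, so that one statement serves both sides of a singular point. *)
Lemma MVT_abs (R : realType) (a b : R) (f df : R -> R) (x y : R) :
  {within `[a, b], continuous f} -> x \in `[a, b] -> y \in `[a, b] -> x != y ->
  (forall c, c \in `]a, b[ -> `|c - x| < `|y - x| -> `|c - y| < `|y - x| ->
     is_derive c 1 f (df c)) ->
  exists c, [/\ c \in `]a, b[, `|c - x| < `|y - x|, `|c - y| < `|y - x| &
     f y - f x = df c * (y - x)].
Proof.
wlog xy : x y / x < y => [wlg|].
  move=> cf xab yab xy df'.
  have [xy'|yx|xyE] := ltgtP x y; last by rewrite xyE eqxx in xy.
    exact: wlg.
  have [||c [cab cy cx E]] := wlg y x yx cf yab xab.
  - by rewrite eq_sym.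
  - by move=> c cab cy cx; apply: df' => //; rewrite [ltRHS]distrC.
  exists c; split=> //; first by rewrite [ltRHS]distrC.
    by rewrite [ltRHS]distrC.
  by rewrite -opprB E; ring.
rewrite !in_itv/= => cf /andP[ax xb] /andP[ay yb] _ dfc.
have near_xy c : c \in `]x, y[ ->
    [/\ c \in `]a, b[, `|c - x| < `|y - x| & `|c - y| < `|y - x|].
  rewrite !in_itv/= => /andP[xc cy].
  rewrite (gtr0_norm (x := y - x)) ?subr_gt0// ger0_norm; last lra.
  by rewrite ltr0_norm; [split; lra | lra].
have [||c cxy E] := @MVT _ f df x y xy.
- by move=> c /near_xy[*]; exact: dfc.
- apply: continuous_subspaceW cf.
  by apply: subset_itv; rewrite bnd_simp.
by exists c; have [] := near_xy c cxy.
Qed.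

(** * Connectedness, extremal points and bounds on an interval *)

Lemma locally_constant_itv (R : realType) (a b : R) (P : R -> Prop) :
  (forall x, x \in `[a, b] -> exists2 d : R, 0 < d &
     forall y, y \in `[a, b] -> `|y - x| < d -> (P x <-> P y)) ->
  forall x y, x \in `[a, b] -> y \in `[a, b] -> P x -> P y.
Proof.
move=> loc x y xab yab Px.
(* The open set is a union of balls of local constancy centred at points of [Q]. Taken for [P] and
   for its negation, it shows that [P] is both relatively open and relatively closed. *)
have nbhd (Q : R -> Prop) : exists2 C : set R, open C &
    (forall t, t \in `[a, b] -> Q t -> C t) /\
    forall t, t \in `[a, b] -> C t ->
      exists s, [/\ s \in `[a, b], Q s & P s <-> P t].
  pose D := [set s | s \in `[a, b] /\ Q s].
  pose r s := if pselect (s \in `[a, b]) is left h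
    then projT1 (cid2 (loc s h)) else 1.
  exists (\bigcup_(s in D) ball s (r s)).
    by apply: bigcup_open => s _; exact: ball_open.
  split.
    move=> t tab Qt; exists t => //; apply: ballxx; rewrite /r.
    by case: pselect => // h; case: cid2.
  move=> t tab [s [sab Qs]]; rewrite /r; case: pselect => // h.
  case: cid2 => d d0 H /=; rewrite /ball/= distrC => std.
  by exists s; split=> //; exact: H.
have [C oC [C1 C2]] := nbhd P; have [D oD [D1 D2]] := nbhd (fun t => ~ P t).
have -> : P y = ([set` `[a, b]] `&` [set t | P t]) y.
  by apply/propext; split=> [Py|[]//]; split.
suff -> : [set` `[a, b]] `&` [set t | P t] = [set` `[a, b]] by [].
apply: (@segment_connected _ a b).
- by exists x.
- exists C => //; apply/seteqP; split=> t [tab /= Pt]; split => //.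
    exact: C1.
  by have [s [_ Ps <-]] := C2 _ tab Pt.
- exists (~` D); first exact: open_closedC.
  apply/seteqP; split=> t [tab /= Pt]; split => //.
    by move=> /(D2 _ tab)[s [_ nPs sPt]]; apply/nPs/sPt.
  by apply: contrapT => nPt; apply/Pt/D1.
Qed.

(** The last hypothesis makes [K] relatively closed, so the infimum of its points in [[w, y]]
    belongs to [K]. *)
Lemma first_hit (R : realType) (w y : R) (K : R -> Prop) :
  w <= y -> K y ->
  (forall x, x \in `[w, y] -> ~ K x -> exists2 d : R, 0 < d &
     forall t, t \in `[w, y] -> `|t - x| < d -> ~ K t) ->
  exists2 b, b \in `[w, y] & K b /\ forall t, w <= t -> t < b -> ~ K t.
Proof.
move=> wy Ky opK; pose A := [set t | t \in `[w, y] /\ K t].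
have Ay : A y by split=> //; rewrite in_itv/= wy lexx.
have hA : has_inf A.
  split; first by exists y.
  by exists w => t [] /=; rewrite in_itv/= => /andP[].
have bA t : A t -> inf A <= t by move=> At; apply: ge_inf => //; case: hA.
have Aw : w <= inf A.
  by apply: lb_le_inf; [exists y; exact: Ay | move=> t [+ _]; rewrite in_itv/= => /andP[]].
have bwy : inf A \in `[w, y] by rewrite in_itv/= Aw bA.
exists (inf A) => //; split.
  apply: contrapT => nK; have [d d0 H] := opK _ bwy nK.
  have [t At tb] := inf_adherent d0 hA; case: (At) => twy Kt.
  apply: (H t twy _ Kt); rewrite ger0_norm ?subr_ge0 ?bA//; lra.
move=> t wt tb Kt; move: (tb); apply/negP; rewrite -leNgt; apply: (bA); split=> //.
by rewrite in_itv/= wt (le_trans (ltW tb))// bA.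
Qed.

Lemma last_hit (R : realType) (y w : R) (K : R -> Prop) :
  y <= w -> K y ->
  (forall x, x \in `[y, w] -> ~ K x -> exists2 d : R, 0 < d &
     forall t, t \in `[y, w] -> `|t - x| < d -> ~ K t) ->
  exists2 a, a \in `[y, w] & K a /\ forall t, a < t -> t <= w -> ~ K t.
Proof.
move=> yw Ky opK.
have [||x xwy nKx|b bwy [Kb Hb]] := @first_hit _ (- w) (- y) (fun t => K (- t)).
- by rewrite lerN2.
- by rewrite opprK.
- have [|d d0 H] := opK (- x) _ nKx.
    by move: xwy; rewrite !in_itv/=; lra.
  exists d => // t twy tx; apply: H.
    by move: twy; rewrite !in_itv/=; lra.
  by rewrite -opprD normrN.
exists (- b); first by move: bwy; rewrite !in_itv/=; lra.
split=> // t bt tw; rewrite -[t]opprK; apply: Hb; lra.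
Qed.

Lemma within_continuous_bounded (R : realType) (a b : R) (f : R -> R) :
  a < b -> {within `[a, b], continuous f} ->
  exists2 M : R, 0 < M & forall t, t \in `[a, b] -> `|f t| <= M.
Proof.
move=> ab cf.
have [|c cab H] := @EVT_max _ (fun t => `|f t|) a b (ltW ab).
  by move=> t; apply: cvg_norm; exact: cf.
by exists (`|f c| + 1) => [|t tab]; rewrite ?ltr_wpDl// (le_trans (H t tab))// lerDl.
Qed.

Lemma lipschitz_itv (R : realType) (a b M : R) (f df : R -> R) :
  {within `[a, b], continuous f} ->
  (forall c, c \in `]a, b[ -> is_derive c 1 f (df c)) ->
  (forall c, c \in `]a, b[ -> `|df c| <= M) ->
  forall x y, x \in `[a, b] -> y \in `[a, b] -> `|f y - f x| <= M * `|y - x|.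
Proof.
move=> cf dfc dfM x y xab yab; have [->|xy] := eqVneq x y.
  by rewrite !subrr normr0 mulr0.
have [|c [cab _ _ ->]] := MVT_abs (df := df) cf xab yab xy.
  by move=> c cab _ _; exact: dfc.
by rewrite normrM ler_wpM2r// dfM.
Qed.

Lemma nonvanishing_same_sign (R : realType) (p q : R) (f : R -> R) :
  {within `[p, q], continuous f} ->
  (forall t, t \in `]p, q[ -> f t != 0) ->
  forall t w, t \in `]p, q[ -> w \in `]p, q[ -> 0 < f t * f w.
Proof.
move=> cf f0 t w; wlog tw : t w / t <= w => [wlg tpq wpq|tpq wpq].
  by have [tw|wt] := leP t w; [|rewrite mulrC]; apply: wlg => //; exact: ltW.
rewrite ltNge; apply/negP => ftw.
move: (tpq) (wpq); rewrite !in_itv/= => /andP[pt tq] /andP[pw wq].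
have [||c ctw fc] := @IVT _ f t w 0 tw.
- by apply: continuous_subspaceW cf; apply: subset_itv; rewrite bnd_simp ltW.
- rewrite ge_min le_max; have [ft|ft] := ltP (f t) 0; apply/andP; split.
  + by rewrite (ltW ft).
  + by apply/orP; right; rewrite leNgt; apply/negP => fw; nra.
  + by have [//|fw] := leP (f w) 0; rewrite ?orbT//; exfalso;
      have := f0 t tpq; have := f0 w wpq; nra.
  + by [].
move: ctw; rewrite in_itv/= => /andP[tc cw].
suff /f0 : c \in `]p, q[ by rewrite fc eqxx.
rewrite in_itv/=; lra.
Qed.

(** * The singular equation when all zeros of [V] are simple and interior *)

Section Rayleigh_Kuo.
Context (R : realType) (a b : R) (V V1 V2 : R -> R) (alpha beta : R)
  (phi phi1 : R -> R).
(** The value that the equation prescribes for the second derivative of [phi], with [V] in the role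
    of [U - c_s]. Below, [Va] and [Vb] deny case (ii) of the theorem, [V1n0] denies (iii) and
    [V2nbeta] denies (i). *)
Let h y := alpha ^+ 2 * phi y - (beta - V2 y) / V y * phi y.
Hypotheses (ab : a < b) (alpha0 : 0 < alpha)
  (dV : forall x, x \in `[a, b] -> deriv_within a b V x (V1 x))
  (dV1 : forall x, x \in `[a, b] -> deriv_within a b V1 x (V2 x))
  (cV2 : {within `[a, b], continuous V2})
  (cphi : {within `[a, b], continuous phi})
  (cphi1 : {within `[a, b], continuous phi1})
  (dphi : forall x, x \in `]a, b[ -> is_derive x 1 phi (phi1 x))
  (dphi1 : forall x, x \in `]a, b[ -> V x != 0 -> is_derive x 1 phi1 (h x))
  (phia : phi a = 0) (phib : phi b = 0) (Va : V a != 0) (Vb : V b != 0)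
  (V1n0 : forall z, z \in `[a, b] -> V z = 0 -> V1 z != 0)
  (V2nbeta : forall z, z \in `[a, b] -> V z = 0 -> beta - V2 z != 0).

Let cV := deriv_within_continuous dV.
Let cV1 := deriv_within_continuous dV1.

(** At a zero of [V] the nonzero slope gives linear growth; elsewhere [|V|] stays above half its
    value and [|y - e| < 1]. Either way [1 / |V y|] is at most of size [1 / |y - e|]. *)
Lemma V_lower_bound e : e \in `[a, b] ->
  exists2 m : R, 0 < m & exists2 d : R, 0 < d &
    forall y, y \in `[a, b] -> `|y - e| < d -> m * `|y - e| <= `|V y|.
Proof.
move=> eab; have [Ve|Ve] := eqVneq (V e) 0.
  have V1e : 0 < `|V1 e| / 2 by rewrite divr_gt0// normr_gt0 V1n0.
  exists (`|V1 e| / 2) => //; have [d d0 H] := deriv_within_ball (dV eab) V1e.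
  exists d => // y yab yd; have := H y yab yd; rewrite Ve subr0 => {}H.
  have := ler_normB (V y) (V y - V1 e * (y - e)).
  rewrite opprB addrC subrK normrM; lra.
have Ve2 : 0 < `|V e| / 2 by rewrite divr_gt0// normr_gt0.
have [d d0 H] := (within_continuous_ball _ _ _).1 cV e eab _ Ve2.
exists (`|V e| / 2) => //; exists (Num.min d 1); first by rewrite lt_min d0 ltr01.
move=> y yab; rewrite lt_min => /andP[yd y1].
have := H y yab yd; rewrite distrC => {}H.
have := ler_normD (V e - V y) (V y); rewrite subrK => H1.
have : `|V e| / 2 * `|y - e| <= `|V e| / 2 by rewrite ler_piMr// ltW.
lra.
Qed.

Lemma phi_lipschitz : exists2 M : R, 0 < M &
  forall x y, x \in `[a, b] -> y \in `[a, b] -> `|phi y - phi x| <= M * `|y - x|.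
Proof.
have [M M0 H] := within_continuous_bounded ab cphi1; exists M => //.
apply: (lipschitz_itv cphi dphi) => c cab; apply: H.
by apply: subset_itv_oo_cc cab.
Qed.

(* If [phi z <> 0] then [phi1' = h] has size [1 / |y - z|] near [z], so the
   increments of [phi1] over [z + t, z + 2 t] do not tend to [0]. *)
Lemma phi_eq0_at_critical_layer z : z \in `[a, b] -> V z = 0 -> phi z = 0.
Proof.
move=> zab Vz; apply/eqP/negPn/negP => phiz.
have az : a < z.
  move: zab; rewrite in_itv/= => /andP[+ _]; rewrite le_eqVlt => /predU1P[az|//].
  by move: Va; rewrite az Vz eqxx.
have zb : z < b.
  move: zab; rewrite in_itv/= => /andP[_]; rewrite le_eqVlt => /predU1P[bz|//].
  by move: Vb; rewrite -bz Vz eqxx.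
have [m m0 [d0 d00 Hm]] := V_lower_bound zab.
have [K K0 HK] : exists2 K : R, 0 < K & forall x y, x \in `[a, b] -> y \in `[a, b] ->
    `|V y - V x| <= K * `|y - x|.
  have [K K0 HK] := within_continuous_bounded ab cV1; exists K => //.
  apply: (lipschitz_itv (df := V1) cV) => c cab.
    by apply: (deriv_within_is_derive cab); apply: dV; apply: subset_itv_oo_cc cab.
  by apply: HK; apply: subset_itv_oo_cc cab.
(* Off the zeros of [V] this is [h * V] with the division cleared. It is continuous across [z],
   where its value [- (beta - V2 z) * phi z] is nonzero. *)
pose W y := alpha ^+ 2 * (phi y * V y) - (beta - V2 y) * phi y.
have cW : {within `[a, b], continuous W}.
  move=> t; apply: cvgB.
    by apply: cvgM; [exact: cvg_cst | apply: cvgM; [exact: cphi | exact: cV]].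
  by apply: cvgM; [apply: cvgB; [exact: cvg_cst | exact: cV2] | exact: cphi].
pose L := `|W z|.
have L0 : 0 < L.
  by rewrite normr_gt0 /W Vz !mulr0 sub0r oppr_eq0 mulf_neq0 ?V2nbeta.
have L2 : 0 < L / 2 by lra.
(* Between [z + t] and [z + 2 t], [|V| <= 2 K t] and [|W| > L / 2] give [|h| > L / (4 K t)], so
   [phi1] would change by more than [L / (4 K)]. Keeping both end values within [L / (8 K)] of
   [phi1 z] contradicts this. *)
have LK : 0 < L / (8 * K) by rewrite divr_gt0// mulr_gt0.
have [d1 d10 H1] := (within_continuous_ball _ _ _).1 cW z zab _ L2.
have [d2 d20 H2] := (within_continuous_ball _ _ _).1 cphi1 z zab _ LK.
have [t t0 [td0 td1 td2 tbz]] : exists2 t : R, 0 < t &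
    [/\ 3 * t <= d0, 3 * t <= d1, 3 * t <= d2 & 3 * t <= b - z].
  exists (Num.min (Num.min d0 d1) (Num.min d2 (b - z)) / 3).
    by rewrite divr_gt0// !lt_min d00 d10 d20 subr_gt0.
  by rewrite mulrCA mulfV ?mulr1 ?pnatr_eq0// !ge_min !lexx ?orbT.
have xab : z + t \in `[a, b] by rewrite in_itv/=; lra.
have yab : z + 2 * t \in `[a, b] by rewrite in_itv/=; lra.
have yx : z + 2 * t - (z + t) = t by ring.
have xy : z + t != z + 2 * t by rewrite -subr_eq0 opprD addrA; apply/eqP; lra.
have in_c c : `|c - (z + t)| < t -> `|c - (z + 2 * t)| < t ->
    [/\ c \in `[a, b], `|c - z| < 2 * t & 0 < `|c - z|].
  rewrite !ltr_norml => cx cy; rewrite in_itv/= ger0_norm; last lra.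
  by split; lra.
have Vc0 c : c \in `[a, b] -> `|c - z| < 2 * t -> 0 < `|c - z| -> V c != 0.
  move=> cab cz zc; rewrite -normr_gt0; apply: lt_le_trans (Hm c cab _); last lra.
  by rewrite mulr_gt0.
have [|c [cab]] := MVT_abs (df := h) cphi1 xab yab xy.
  rewrite yx (gtr0_norm t0) => c cab cx cy; have [cab' cz zc] := in_c c cx cy.
  by apply: dphi1 => //; exact: Vc0.
rewrite yx (gtr0_norm t0) => cx cy; have [cab' cz zc] := in_c c cx cy.
move=> /(congr1 Num.norm); rewrite normrM (gtr0_norm t0) => E.
have phi1_small : `|phi1 (z + 2 * t) - phi1 (z + t)| < L / (4 * K).
  have -> : L / (4 * K) = L / (8 * K) + L / (8 * K) by field; rewrite gt_eqF.
  rewrite -(subrKA (phi1 z)) (le_lt_trans (ler_normD _ _))// ltrD//.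
    apply: H2 => //; rewrite addrC addKr gtr0_norm; lra.
  by rewrite distrC; apply: H2 => //; rewrite addrC addKr gtr0_norm; lra.
have Wc : L / 2 < `|W c|.
  have cd1 : `|c - z| < d1 by lra.
  have := H1 c cab' cd1; rewrite distrC.
  have := ler_normD (W z - W c) (W c); rewrite subrK -/L; lra.
have Wh : W c = h c * V c by rewrite /W /h; field; exact: Vc0.
have VcK : `|V c| <= K * (2 * t).
  have := HK z c zab cab'; rewrite Vz subr0 => /le_trans; apply.
  by rewrite ler_wpM2l// ltW.
move: phi1_small; rewrite E ltr_pdivlMr ?mulr_gt0// => small.
have : `|W c| <= `|h c| * (K * (2 * t)) by rewrite Wh normrM ler_wpM2l.
lra.
Qed.

(** Near [w], [|h|] is at most [C * |phi y| / |y - w|]. If [M] is the maximum of [|phi1|] within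
    distance [d], then [|phi y| <= M * |y - w|] because [phi w = 0]; the singular factor cancels and
    [|h| <= C * M]. As [phi1 w = 0], the mean value theorem gives [M <= C * M * d <= M / 2], hence
    [M = 0]. *)
Lemma unique_continuation_local w : w \in `[a, b] -> phi w = 0 -> phi1 w = 0 ->
  exists2 d : R, 0 < d &
    forall y, y \in `[a, b] -> `|y - w| < d -> phi y = 0 /\ phi1 y = 0.
Proof.
move=> wab phiw phi1w.
have [m m0 [d0 d00 Hm]] := V_lower_bound wab.
have [MV MV0 HMV] := within_continuous_bounded ab cV.
have [M2 M20 HM2] := within_continuous_bounded ab cV2.
have [C C0 hC] : exists2 C : R, 0 < C & forall y, y \in `[a, b] ->
    0 < `|y - w| -> `|y - w| < d0 ->
    V y != 0 /\ `|h y| * `|y - w| <= C * `|phi y|.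
  exists ((alpha ^+ 2 * MV + `|beta| + M2) / m).
    by rewrite divr_gt0// ltr_wpDl// addr_ge0// mulr_ge0 ?sqr_ge0// ltW.
  move=> y yab yw yd; have Hmy := Hm y yab yd.
  have Vy : V y != 0.
    by rewrite -normr_gt0; apply: lt_le_trans Hmy; rewrite mulr_gt0.
  split => //.
  have hV : `|h y| * `|V y| <= (alpha ^+ 2 * MV + `|beta| + M2) * `|phi y|.
    rewrite -normrM.
    have -> : h y * V y = (alpha ^+ 2 * V y - (beta - V2 y)) * phi y.
      by rewrite /h; field.
    rewrite normrM ler_wpM2r// (le_trans (ler_normB _ _))// -addrA lerD//.
      by rewrite normrM ger0_norm ?sqr_ge0// ler_wpM2l ?sqr_ge0 ?HMV.
    by rewrite (le_trans (ler_normB _ _))// lerD2l HM2.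
  rewrite mulrAC ler_pdivlMr//; apply: le_trans hV.
  by rewrite -mulrA ler_wpM2l// mulrC.
(* The halving yields both [d < d0] and [C * d <= 1 / 2], the latter making the estimate for [phi1]
   contract. *)
pose d := Num.min d0 (C^-1) / 2.
have d_gt0 : 0 < d by rewrite divr_gt0// lt_min d00 invr_gt0.
have dd0 : d < d0.
  have : Num.min d0 C^-1 <= d0 by rewrite ge_min lexx.
  by move: d_gt0; rewrite /d; lra.
have dC : C * d <= 2^-1.
  have : Num.min d0 C^-1 <= C^-1 by rewrite ge_min lexx orbT.
  rewrite -(ler_pM2l C0) mulfV ?gt_eqF// /d; lra.
pose p := Num.max a (w - d); pose q := Num.min b (w + d).
have pqE y : (y \in `[p, q]) = (y \in `[a, b]) && (`|y - w| <= d).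
  rewrite !in_itv/= ge_max le_min ler_norml; apply/idP/idP; lra.
have wpq : w \in `[p, q] by rewrite pqE wab subrr normr0 ltW.
have pq : p <= q by move: wpq; rewrite in_itv/= => /andP[]; exact: le_trans.
have pqab : [set` `[p, q]] `<=` [set` `[a, b]] by move=> y /=; rewrite pqE => /andP[].
have pqab' y : y \in `]p, q[ -> y \in `]a, b[.
  by rewrite !in_itv/= gt_max lt_min; lra.
have cphi_pq := continuous_subspaceW pqab cphi.
have cphi1_pq := continuous_subspaceW pqab cphi1.
have [|y0 y0pq y0max] := @EVT_max _ (fun t => `|phi1 t|) p q pq.
  by move=> t; apply: cvg_norm; exact: cphi1_pq.
have phi_le y : y \in `[p, q] -> `|phi y| <= `|phi1 y0| * `|y - w|.
  move=> ypq; rewrite -[phi y]subr0 -phiw.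
  have dpq c : c \in `]p, q[ -> is_derive c 1 phi (phi1 c).
    by move=> cpq; exact: dphi (pqab' c cpq).
  have phi1_le c : c \in `]p, q[ -> `|phi1 c| <= `|phi1 y0|.
    by move=> cpq; apply: y0max; apply: subset_itv_oo_cc cpq.
  have := lipschitz_itv cphi_pq dpq phi1_le; exact.
have phi1y0 : `|phi1 y0| = 0.
  have [->|wy0] := eqVneq y0 w; first by rewrite phi1w normr0.
  (* The strict bound [|c - y0| < |y0 - w|] rules out [c = w], the one point of this neighbourhood
     where [V] may vanish. *)
  have cP c : c \in `]p, q[ -> `|c - y0| < `|y0 - w| ->
      V c != 0 /\ `|h c| * `|c - w| <= C * `|phi c| /\ 0 < `|c - w|.
    move=> /subset_itv_oo_cc; rewrite pqE => /andP[cab cd] cy0.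
    have cw : 0 < `|c - w|.
      rewrite normr_gt0 subr_eq0; apply: contraTneq cy0 => ->.
      by rewrite distrC ltxx.
    by have [] := hC c cab cw (le_lt_trans cd dd0).
  have [||c [cpq cw cy0 E]] := MVT_abs (df := h) cphi1_pq wpq y0pq.
  - by rewrite eq_sym.
  - by move=> c cpq _ /(cP c cpq)[Vc _]; apply: dphi1 => //; exact: pqab'.
  have [Vc [hc cw0]] := cP c cpq cy0.
  have phic := phi_le c (subset_itv_oo_cc cpq).
  have hc' : `|h c| <= C * `|phi1 y0|.
    rewrite -(ler_pM2r cw0) (le_trans hc)// -mulrA ler_wpM2l//; exact: ltW.
  move: E; rewrite phi1w subr0 => /(congr1 Num.norm); rewrite normrM => E.
  have y0d : `|y0 - w| <= d by move: y0pq; rewrite pqE => /andP[].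
  have : `|phi1 y0| <= C * `|phi1 y0| * d by rewrite {1}E ler_pM.
  have := normr_ge0 (phi1 y0).
  nra.
exists d => // y yab yd; have ypq : y \in `[p, q] by rewrite pqE yab ltW.
have := y0max y ypq; have := phi_le y ypq; rewrite phi1y0 mul0r.
by rewrite !normr_le0 => /eqP -> /eqP ->.
Qed.

(** The common zeros of [phi] and [phi1] form a set that is relatively open by local uniqueness and
    relatively closed by continuity. *)
Lemma unique_continuation w : w \in `[a, b] -> phi w = 0 -> phi1 w = 0 ->
  forall y, y \in `[a, b] -> phi y = 0.
Proof.
move=> wab phiw phi1w y yab.
suff : phi y = 0 /\ phi1 y = 0 by case.
apply: (@locally_constant_itv _ a b (fun t => phi t = 0 /\ phi1 t = 0) _ w) => //.
move=> {y yab} x xab; have [[px p1x]|npx] := pselect (phi x = 0 /\ phi1 x = 0).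
  by have [d d0 H] := unique_continuation_local xab px p1x; exists d => // y yab /(H y yab).
have away (f : R -> R) : {within `[a, b], continuous f} -> f x != 0 ->
    exists2 d : R, 0 < d & forall y, y \in `[a, b] -> `|y - x| < d -> f y != 0.
  move=> cf fx; have fx0 : 0 < `|f x| by rewrite normr_gt0.
  have [d d0 H] := (within_continuous_ball _ _ _).1 cf x xab _ fx0.
  exists d => // y yab yd; apply: contraTneq (H y yab yd) => ->.
  by rewrite sub0r normrN ltxx.
have [px|px] := eqVneq (phi x) 0.
  have [|d d0 H] := away phi1 cphi1; first by apply/eqP => p1x; apply: npx.
  by exists d => // y yab yd; split=> [/npx//|[_ /eqP]]; rewrite (negbTE (H y yab yd)).
have [d d0 H] := away phi cphi px.
by exists d => // y yab yd; split=> [/npx//|[/eqP]]; rewrite (negbTE (H y yab yd)).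
Qed.

(* The function [phi1 phi - V1 phi^2 / V] tends to [0] at both ends of the
   interval, and its derivative
   [alpha^2 phi^2 - beta phi^2 / V + (phi1 - V1 phi / V)^2] is a sum of
   nonnegative terms; Rolle's theorem yields a point where all of them vanish. *)
Lemma Rolle_Rayleigh p q : p \in `[a, b] -> q \in `[a, b] -> p < q ->
  phi p = 0 -> phi q = 0 ->
  (forall t, t \in `]p, q[ -> V t != 0 /\ beta * V t <= 0) ->
  exists2 c, c \in `[a, b] & phi c = 0 /\ phi1 c = 0.
Proof.
move=> pab qab pq phip phiq Vpq.
pose H t := phi1 t * phi t - V1 t * (phi t * (phi t / V t)).
(* The terms in [V2] cancel and the terms in [phi1] complete a square. Writing [beta * phi^2 / V] as
   [beta * V * (phi / V)^2] lets the sign hypothesis apply directly. *)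
pose dH t := alpha ^+ 2 * phi t ^+ 2 - beta * V t * (phi t / V t) ^+ 2
  + (phi1 t - V1 t * (phi t / V t)) ^+ 2.
have pqab t : t \in `]p, q[ -> t \in `]a, b[.
  by move: pab qab; rewrite !in_itv/= => /andP[? ?] /andP[? ?]; lra.
have dH_ t : t \in `]p, q[ -> is_derive t 1 H (dH t).
  move=> tpq; have tab := pqab t tpq; have [Vt _] := Vpq t tpq.
  have tab' := subset_itv_oo_cc tab.
  have ? : is_derive t 1 phi (phi1 t) := dphi tab.
  have ? : is_derive t 1 phi1 (h t) := dphi1 tab Vt.
  have ? : is_derive t 1 V (V1 t) := deriv_within_is_derive tab (dV tab').
  have ? : is_derive t 1 V1 (V2 t) := deriv_within_is_derive tab (dV1 tab').
  have dVi : is_derive t 1 (fun y => (V y)^-1) (- (V t) ^- 2 *: V1 t).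
    exact: is_deriveV.
  apply: is_derive_eq; rewrite /GRing.scale/= /dH /h.
  by field.
(* Where [phi] vanishes, its Lipschitz bound against the lower bound on [|V|] keeps [phi / V]
   bounded by [L / m], even if [V] vanishes too; the remaining factor [phi] drives [H] to [0]. *)
have H_small e : e \in `[a, b] -> phi e = 0 -> forall eps, 0 < eps ->
    exists2 d : R, 0 < d & forall y, y \in `[a, b] -> `|y - e| < d -> `|H y| < eps.
  move=> eab phie eps eps0.
  have [m m0 [d0 d00 Hm]] := V_lower_bound eab.
  have [L L0 HL] := phi_lipschitz.
  have [M M0 HM] := within_continuous_bounded ab cphi1.
  have [K K0 HK] := within_continuous_bounded ab cV1.
  pose C := L * (M + K * (L / m)).
  have C0 : 0 < C by rewrite /C mulr_gt0// addr_gt0// mulr_gt0// divr_gt0.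
  exists (Num.min d0 (eps / C)); first by rewrite lt_min d00 divr_gt0.
  move=> y yab; rewrite lt_min => /andP[yd0]; rewrite ltr_pdivlMr// => yeps.
  have phiy : `|phi y| <= L * `|y - e|.
    by have := HL e y eab yab; rewrite phie subr0.
  have phiV : `|phi y / V y| <= L / m.
    have [Vy|Vy] := eqVneq (V y) 0.
      by rewrite Vy invr0 mulr0 normr0 divr_ge0 ?ltW.
    rewrite normrM normfV ler_pdivrMr ?normr_gt0// (le_trans phiy)//.
    by rewrite -mulrA ler_wpM2l ?(ltW L0)// ler_pdivlMl// Hm.
  have -> : H y = phi y * (phi1 y - V1 y * (phi y / V y)) by rewrite /H; ring.
  rewrite normrM; apply: le_lt_trans yeps.
  have -> : `|y - e| * C = (L * `|y - e|) * (M + K * (L / m)) by rewrite /C; ring.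
  apply: ler_pM => //.
  rewrite (le_trans (ler_normB _ _))// lerD ?HM// normrM ler_pM//; exact: HK.
(* Inversion is total, so [H e = 0] even if [V e = 0], in agreement with the limit; thus [H] is
   continuous up to the ends. *)
have He e : phi e = 0 -> H e = 0 by move=> phie; rewrite /H phie !mul0r !mulr0 subr0.
have cH : {within `[p, q], continuous H}.
  apply/within_continuous_ball => x xpq eps eps0.
  have pqab' y : y \in `[p, q] -> y \in `[a, b].
    by move: pab qab; rewrite !in_itv/= => /andP[? ?] /andP[? ?]; lra.
  have [x0|x0] := eqVneq (phi x) 0.
    have [d d0 Hd] := H_small x (pqab' x xpq) x0 eps eps0.
    by exists d => // y ypq; rewrite (He x)// subr0; apply: Hd; exact: pqab'.
  have xpq' : x \in `]p, q[.
    move: xpq; rewrite !in_itv/= !lt_neqAle => /andP[-> ->]; rewrite !andbT.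
    apply/andP; split.
      by apply: contraNneq x0 => <-; apply/eqP.
    by apply: contraNneq x0 => ->; apply/eqP.
  have : {for x, continuous H}.
    by apply/differentiable_continuous/derivable1_diffP; case: (dH_ x xpq').
  move=> /cvgrPdist_lt /(_ eps eps0) /nbhs_ballP[d /= d0 Hd].
  by exists d => // y _ yx; rewrite distrC; apply: Hd; rewrite /ball/= distrC.
have [c cpq] := MVT pq dH_ cH.
rewrite (He p)// (He q)// subrr => /esym/eqP.
rewrite mulf_eq0 subr_eq0 (gt_eqF pq) orbF => /eqP dHc.
have [Vc bVc] := Vpq c cpq.
have s1 : 0 <= alpha ^+ 2 * phi c ^+ 2 by rewrite mulr_ge0 ?sqr_ge0.
have s2 : beta * V c * (phi c / V c) ^+ 2 <= 0 by rewrite mulr_le0_ge0 ?sqr_ge0.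
have s3 := sqr_ge0 (phi1 c - V1 c * (phi c / V c)).
have phic : phi c = 0.
  have /eqP : alpha ^+ 2 * phi c ^+ 2 = 0 by move: dHc; rewrite /dH; lra.
  by rewrite mulf_eq0 !expf_eq0/= (gt_eqF alpha0)/= => /eqP.
exists c; first exact/subset_itv_oo_cc/pqab.
split=> //; have /eqP : (phi1 c - V1 c * (phi c / V c)) ^+ 2 = 0.
  by move: dHc; rewrite /dH; lra.
by rewrite phic mul0r mulr0 subr0 expf_eq0/= => /eqP.
Qed.

(** [V] changes sign at its simple zero [z], so [beta * V] is nonpositive on at least one side of
    it. *)
Lemma exists_nonpos_side z : z \in `[a, b] -> V z = 0 ->
  exists w, [/\ w \in `]a, b[, V w != 0 & beta * V w <= 0].
Proof.
move=> zab Vz.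
have az : a < z.
  move: zab; rewrite in_itv/= => /andP[+ _]; rewrite le_eqVlt => /predU1P[az|//].
  by move: Va; rewrite az Vz eqxx.
have zb : z < b.
  move: zab; rewrite in_itv/= => /andP[_]; rewrite le_eqVlt => /predU1P[bz|//].
  by move: Vb; rewrite -bz Vz eqxx.
have V1z := V1n0 zab Vz.
have V1z2 : 0 < `|V1 z| / 2 by rewrite divr_gt0// normr_gt0.
have [d d0 H] := deriv_within_ball (dV zab) V1z2.
have [t t0 [td taz tzb]] : exists2 t : R, 0 < t & [/\ t < d, t < z - a & t < b - z].
  exists (Num.min d (Num.min (z - a) (b - z)) / 2).
    by rewrite divr_gt0// !lt_min d0 !subr_gt0 az.
  by rewrite !ltr_pdivrMr//; split; rewrite !gt_min; apply/orP; [left|right|right];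
    rewrite ?gt_min; try (apply/orP; [left|right]); lra.
(* The direction is chosen so that [beta] times the linear part [V1 z * s] is nonpositive. The error
   being at most half of [|V1 z * s|], [V] has the sign of this linear part at [z + s]. *)
pose s : R := if beta * V1 z <= 0 then t else - t.
have ss : `|s| = t by rewrite /s; case: ifP => _; rewrite ?normrN gtr0_norm.
have bs : beta * V1 z * s <= 0.
  rewrite /s; case: ifPn => [b0|]; first by rewrite mulr_le0_ge0// ltW.
  by rewrite -ltNge => b0; rewrite mulr_ge0_le0 ?oppr_le0// ltW.
have wab : z + s \in `]a, b[.
  by move: ss (ler_norm s) (ler_norm (- s)); rewrite in_itv/= normrN; lra.
have := H (z + s) (subset_itv_oo_cc wab).
rewrite addrC addKr ss => /(_ td); rewrite Vz subr0 => Hs.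
have k0 : 0 < V (z + s) * (V1 z * s).
  have kn : `|V1 z * s| = `|V1 z| * t by rewrite normrM ss.
  have k1 : 0 < `|V1 z| * t by rewrite mulr_gt0// normr_gt0.
  move: Hs kn; have [?|?] := ltP 0 (V1 z * s).
    rewrite (gtr0_norm (x := V1 z * s))// ler_norml => /andP[? _] ?.
    by rewrite mulr_gt0//; lra.
  rewrite (ler0_norm (x := V1 z * s))// ler_norml => /andP[_ ?] ?.
  by rewrite nmulr_rgt0//; lra.
exists (z + s); split => //.
  by apply: contraTneq k0 => ->; rewrite mul0r ltxx.
rewrite leNgt; apply/negP => bV.
have : 0 < beta * V (z + s) * (V (z + s) * (V1 z * s)) by rewrite mulr_gt0.
have -> : beta * V (z + s) * (V (z + s) * (V1 z * s))
  = V (z + s) ^+ 2 * (beta * V1 z * s) by ring.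
by rewrite ltNge mulr_ge0_le0 ?sqr_ge0.
Qed.

Lemma trivial_mode z : z \in `[a, b] -> V z = 0 ->
  forall y, y \in `[a, b] -> phi y = 0.
Proof.
move=> zab Vz; have [w [wab Vw bVw]] := exists_nonpos_side zab Vz.
have [aw wb] : a < w /\ w < b by move: wab; rewrite in_itv/= => /andP.
have open_away e x : x \in `[a, b] -> ~ (V x = 0 \/ x = e) ->
    exists2 d : R, 0 < d &
      forall t, t \in `[a, b] -> `|t - x| < d -> ~ (V t = 0 \/ t = e).
  move=> xab nx.
  have Vx : 0 < `|V x| by rewrite normr_gt0; apply/eqP => Vx; apply: nx; left.
  have xe : 0 < `|e - x|.
    by rewrite normr_gt0 subr_eq0; apply/eqP => ex; apply: nx; right.
  have [d d0 H] := (within_continuous_ball _ _ _).1 cV x xab _ Vx.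
  exists (Num.min d `|e - x|); first by rewrite lt_min d0.
  move=> t tab; rewrite lt_min => /andP[td te] [Vt|tE].
    by have := H t tab td; rewrite Vt sub0r normrN ltxx.
  by move: te; rewrite tE ltxx.
have sub c d x : a <= c -> d <= b -> x \in `[c, d] -> x \in `[a, b].
  by rewrite !in_itv/=; lra.
(* Counting [b] as a hit along with the zeros of [V] ensures that a first hit exists. There [phi]
   vanishes in either case, by the boundary condition or by [phi_eq0_at_critical_layer]. The same is
   done to the left with [a]. *)
have [|x xwb nx|q qwb [Kq Hq]] := @first_hit _ w b (fun t => V t = 0 \/ t = b) (ltW wb).
- by right.
- have [d d0 H] := open_away b x (sub _ _ _ (ltW aw) (lexx b) xwb) nx.
  by exists d => // t /(sub _ _ _ (ltW aw) (lexx b)); exact: H.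
have [|x xwb nx|p paw [Kp Hp]] := @last_hit _ a w (fun t => V t = 0 \/ t = a) (ltW aw).
- by right.
- have [d d0 H] := open_away a x (sub _ _ _ (lexx a) (ltW wb) xwb) nx.
  by exists d => // t /(sub _ _ _ (lexx a) (ltW wb)); exact: H.
have pab := sub _ _ _ (lexx a) (ltW wb) paw.
have qab := sub _ _ _ (ltW aw) (lexx b) qwb.
have pw : p < w.
  move: paw; rewrite in_itv/= => /andP[_]; rewrite le_eqVlt => /predU1P[pw|//].
  by case: Kp => E; [rewrite -pw E eqxx in Vw | move: aw; rewrite -pw E ltxx].
have wq : w < q.
  move: qwb; rewrite in_itv/= le_eqVlt => /andP[/predU1P[wq|//] _].
  by case: Kq => E; [rewrite wq E eqxx in Vw | move: wb; rewrite wq E ltxx].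
have V0 t : t \in `]p, q[ -> V t != 0.
  rewrite in_itv/= => /andP[pt tq]; apply/eqP => Vt.
  by have [tw|wt] := leP t w; [apply: (Hp t) => // | apply: (Hq t) => //; [exact: ltW|]]; left.
have cVpq : {within `[p, q], continuous V}.
  apply: continuous_subspaceW cV => t; apply: sub.
    by move: pab; rewrite in_itv/= => /andP[].
  by move: qab; rewrite in_itv/= => /andP[].
have phip : phi p = 0.
  by case: Kp => [Vp|->//]; exact: phi_eq0_at_critical_layer.
have phiq : phi q = 0.
  by case: Kq => [Vq|->//]; exact: phi_eq0_at_critical_layer.
have [t tpq|c cab [phic phi1c]] := Rolle_Rayleigh pab qab (lt_trans pw wq) phip phiq.
  split; first exact: V0.
  have wpq : w \in `]p, q[ by rewrite in_itv/= pw.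
  have tw := nonvanishing_same_sign cVpq V0 tpq wpq.
  rewrite leNgt; apply/negP => bVt.
  have : 0 < beta * V t * (V t * V w) by rewrite mulr_gt0.
  have -> : beta * V t * (V t * V w) = V t ^+ 2 * (beta * V w) by ring.
  by rewrite ltNge mulr_ge0_le0 ?sqr_ge0.
exact: unique_continuation cab phic phi1c.
Qed.

End Rayleigh_Kuo.

(** * Passage from the weak formulation to the classical equation *)

Lemma within_continuous_Rintegral (R : realType) (a b : R) (F f : R -> R) :
  a <= b -> lebesgue_measure.-integrable `[a, b] (EFin \o f) ->
  (forall x, x \in `[a, b] ->
     F x = F a + Rintegral lebesgue_measure `[a, x] f) ->
  {within `[a, b], continuous F}.
Proof.
move=> ab intf FE; apply/within_continuous_ball => x xab e e0.
have := parameterized_integral_continuous ab intf.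
move=> /within_continuous_ball /(_ x xab e e0)[d d0 H]; exists d => // y yab yx.
by rewrite (FE y yab) (FE x xab) opprD addrACA subrr add0r; exact: H.
Qed.

(** Comparison with [1 + g^2], integrable because the interval is bounded. *)
Lemma integrable_of_sqr (R : realType) (a b : R) (g : R -> R) :
  measurable_fun `[a, b] g ->
  lebesgue_measure.-integrable `[a, b] (fun t => ((g t) ^+ 2)%:E) ->
  lebesgue_measure.-integrable `[a, b] (EFin \o g).
Proof.
move=> mg ig.
have i1 : lebesgue_measure.-integrable `[a, b] (EFin \o (fun=> 1 : R)).
  apply: continuous_compact_integrable; first exact: segment_compact.
  by apply: continuous_subspaceT => ?; exact: cvg_cst.
apply: (le_integrable _ _ _ (integrableD _ i1 ig)) => //.
  exact/measurable_EFinP.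
move=> t _ /=; rewrite lee_fin [leRHS]ger0_norm; last by rewrite addr_ge0// sqr_ge0.
rewrite ler_norml; apply/andP; split; nra.
Qed.

(** [V] has no zero on a small interval around [x], so [h] is continuous there and agrees with [g]
    almost everywhere; [is_derive_Rintegral] applies. *)
Lemma is_derive_ode (R : realType) (a b : R) (V V2 phi phi1 g : R -> R)
    (alpha beta x : R) :
  let h y := alpha ^+ 2 * phi y - (beta - V2 y) / V y * phi y in
  {within `[a, b], continuous V} -> {within `[a, b], continuous V2} ->
  {within `[a, b], continuous phi} ->
  lebesgue_measure.-integrable `[a, b] (EFin \o g) ->
  (forall y, y \in `[a, b] ->
     phi1 y = phi1 a + Rintegral lebesgue_measure `[a, y] g) ->
  {ae (lebesgue_measure : measure _ R), forall y,
     y \in `]a, b[ -> V y != 0 -> g y = h y} ->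
  x \in `]a, b[ -> V x != 0 -> is_derive x 1 phi1 (h x).
Proof.
move=> h cV cV2 cphi ig phi1E gh xab Vx.
have Vx0 : 0 < `|V x| by rewrite normr_gt0.
have [d d0 H] := (within_continuous_ball _ _ _).1 cV x (subset_itv_oo_cc xab) _ Vx0.
have [ax xb] : a < x /\ x < b by move: xab; rewrite in_itv/= => /andP.
have [t t0 [td taz tzb]] : exists2 t : R, 0 < t & [/\ t < d, t < x - a & t < b - x].
  exists (Num.min d (Num.min (x - a) (b - x)) / 2).
    by rewrite divr_gt0// !lt_min d0 !subr_gt0 ax.
  by rewrite !ltr_pdivrMr//; split; rewrite !gt_min; apply/orP; [left|right|right];
    rewrite ?gt_min; try (apply/orP; [left|right]); lra.
have pqab : [set` `[x - t, x + t]] `<=` [set` `[a, b]].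
  by apply: subset_itv; rewrite bnd_simp; lra.
have Vpq y : y \in `[x - t, x + t] -> V y != 0.
  move=> ypq; apply: contraTneq (H y (pqab y ypq) _) => [->|].
    by rewrite sub0r normrN ltxx.
  move: ypq; rewrite in_itv/= => ?; rewrite ltr_norml; lra.
apply: (@is_derive_Rintegral _ a b (x - t) (x + t) x phi1 g h _ _ _ _ ig) => //.
- by lra.
- by lra.
- by lra.
- by lra.
- apply/subspace_continuousP => y ypq.
  have c f : {within `[a, b], continuous f} ->
      f z @[z --> within `[x - t, x + t] (nbhs y)] --> (f y : R).
    by move=> /(continuous_subspaceW pqab)/subspace_continuousP; exact.
  apply: cvgB; first by apply: cvgM; [exact: cvg_cst | exact: c].
  apply: cvgM; last exact: c.
  apply: cvgM; first by apply: cvgB; [exact: cvg_cst | exact: c].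
  by apply: cvgV; [exact: Vpq | exact: c].
- apply: filterS gh; first exact: (ae_filter_ringOfSetsType lebesgue_measure).
  move=> y Hy ypq; apply: Hy; last by apply: Vpq; exact: subset_itv_oo_cc.
  by move: ypq; rewrite !in_itv/= => /andP[? ?]; lra.
Qed.

Theorem theorem2p1 (R : realType) (y1 y2 : R) (U U1 U2 : R -> R)
  (c_s alpha_s beta : R) (phi_s g : R -> R) :
  y1 < y2 ->
  C2_on y1 y2 U U1 U2 ->
  (* level sets of U are finite for every c in (U_min, U_max) *)
  (forall c : R,
     (exists z1 z2, z1 \in `[y1, y2] /\ z2 \in `[y1, y2] /\ U z1 < c < U z2) ->
     finite_set [set y | y \in `[y1, y2] /\ U y = c]) ->
  (* neutral mode *)
  0 < alpha_s ->
  H2_with_second_deriv y1 y2 phi_s g ->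
  (exists y, y \in `[y1, y2] /\ phi_s y != 0) ->
  {ae (lebesgue_measure : measure _ R), forall y,
     y \in `]y1, y2[ -> U y != c_s ->
     - g y + alpha_s ^+ 2 * phi_s y - (beta - U2 y) / (U y - c_s) * phi_s y = 0} ->
  phi_s y1 = 0 -> phi_s y2 = 0 ->
  (exists z, z \in `[y1, y2] /\ c_s = U z /\ beta = U2 z) \/
  (c_s = U y1 \/ c_s = U y2) \/
  (exists z, z \in `[y1, y2] /\ U1 z = 0 /\ c_s = U z) \/
  (forall z, z \in `[y1, y2] -> U z != c_s).
Proof.
move=> y12 [dU [dU1 cU2]] _ alpha0 [mg [ig2 [phi1 [phi1E phiE]]]] [y [yab phiy]]
  ode phi_y1 phi_y2.
(* Denying (iv) supplies a zero of [V], and denying (i)-(iii) supplies the hypotheses of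
   [trivial_mode], whose conclusion contradicts [phi_s y != 0]. *)
apply: contrapT => nC; pose V t := U t - c_s.
have VE t : V t = 0 -> c_s = U t by move=> /eqP; rewrite subr_eq0 => /eqP.
have [z zab Vz] : exists2 z, z \in `[y1, y2] & V z = 0.
  apply: contrapT => nz; apply: nC; right; right; right => z zab.
  by rewrite -subr_eq0; apply/eqP => Vz; apply: nz; exists z.
have dV x : x \in `[y1, y2] -> deriv_within y1 y2 V x (U1 x).
  move=> xab; have := dU x xab; rewrite /deriv_within.
  suff -> : (fun t => (V t - V x) / (t - x)) = (fun t => (U t - U x) / (t - x)) by [].
  by apply/funext => t; rewrite /V; congr (_ / _); ring.
have ig := integrable_of_sqr mg ig2.
have cphi1 := within_continuous_Rintegral (ltW y12) ig phi1E.
have iphi1 := continuous_compact_integrable (@segment_compact _ y1 y2) cphi1.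
have cphi := within_continuous_Rintegral (ltW y12) iphi1 phiE.
have dphi x : x \in `]y1, y2[ -> is_derive x 1 phi_s (phi1 x).
  rewrite in_itv/= => /andP[ax xb].
  (* Midpoints towards [y1] and [y2] give an interval around [x] strictly inside []y1, y2[]. *)
  apply: (@is_derive_Rintegral _ y1 y2 ((y1 + x) / 2) ((x + y2) / 2) x _ phi1
    phi1 _ _ _ _ iphi1) => //; [lra|lra|lra|lra| |].
    by apply: continuous_subspaceW cphi1; apply: subset_itv; rewrite bnd_simp; lra.
  by apply: aeW.
move/eqP: phiy; apply.
apply: (@trivial_mode _ y1 y2 V U1 U2 alpha_s beta phi_s phi1 _ _ _ _ _ _ _ _ _
  _ _ _ _ _ _ z) => //.
- move=> x xab Vx.
  apply: (is_derive_ode (deriv_within_continuous dV) cU2 cphi ig phi1E) => //.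
  apply: filterS ode; first exact: (ae_filter_ringOfSetsType lebesgue_measure).
  move=> t Ht tab Vt; have := Ht tab; rewrite -subr_eq0 => /(_ Vt).
  rewrite -/(V t); lra.
- by apply/eqP => /VE E; apply: nC; right; left; left.
- by apply/eqP => /VE E; apply: nC; right; left; right.
- move=> t tab /VE E; apply/eqP => U1t.
  by apply: nC; right; right; left; exists t.
- move=> t tab /VE E; rewrite subr_eq0; apply/eqP => U2t.
  by apply: nC; left; exists t.
Qed.
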